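(* As formal power series in $q$, $$\sum_{n=0}^{\infty} S(2n)q^n = \frac{f_2f_8f_{12}^2}{f_1f_3f_4f_6f_{24}},\qquad \sum_{n=0}^{\infty} S(2n+1)q^n = \frac{f_4^2f_{24}}{f_1f_3f_8f_{12}}.$$
   Context: Let $(a;q)_\infty:=\prod_{k\geq 0}(1-aq^k)$ and, for a positive integer $r$, $f_r:=(q^r;q^r)_\infty=\prod_{k\geq1}(1-q^{rk})$. The function $S(n)$ (the number of overpartitions of $n$ of Schur-type, in the sense of Broudy and Lovejoy) is defined by the generating function $$\sum_{n=0}^{\infty} S(n)q^n = \frac{1}{(q;q^6)_\infty(q^5;q^6)_\infty(q^6;q^6)_\infty}.$$ *)

(* Defs.v *)
From HB Require Import structures.
From mathcomp Require Import all_boot all_order all_algebra.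
From mathcomp Require Import boolp classical_sets.

Set Implicit Arguments.
Unset Strict Implicit.
Unset Printing Implicit Defensive.

Import GRing.Theory.

Local Open Scope ring_scope.

(* [FPS a] is the generating function of the sequence [a].                    *)
Record fps (R : Type) : Type := FPS { fps_coef : nat -> R }.

Notation "u `[ n ]" := (fps_coef u n)
  (at level 2, left associativity, format "u `[ n ]").

Lemma fpsP (R : Type) (u v : fps R) : (forall n, u`[n] = v`[n]) <-> u = v.
Proof.
split=> [|-> //]; case: u v => [a] [b] /= eq_ab.
by congr FPS; apply/funext.
Qed.

HB.instance Definition _ (R : Type) := gen_eqMixin (fps R).
HB.instance Definition _ (R : Type) := gen_choiceMixin (fps R).

Section FpsZmodule.
Context {R : zmodType}.
Implicit Types u v w : fps R.

Definition fps_zero : fps R := FPS (fun=> 0).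
Definition fps_opp u : fps R := FPS (fun n => - u`[n]).
Definition fps_add u v : fps R := FPS (fun n => u`[n] + v`[n]).

Fact fps_addA : associative fps_add.
Proof. by move=> u v w; apply/fpsP => n /=; rewrite addrA. Qed.
Fact fps_addC : commutative fps_add.
Proof. by move=> u v; apply/fpsP => n /=; rewrite addrC. Qed.
Fact fps_add0 : left_id fps_zero fps_add.
Proof. by move=> u; apply/fpsP => n /=; rewrite add0r. Qed.
Fact fps_addN : left_inverse fps_zero fps_opp fps_add.
Proof. by move=> u; apply/fpsP => n /=; rewrite addNr. Qed.

HB.instance Definition _ :=
  GRing.isZmodule.Build (fps R) fps_addA fps_addC fps_add0 fps_addN.

Lemma coef0fps n : (0 : fps R)`[n] = 0. Proof. by []. Qed.
Lemma coefNfps u n : (- u)`[n] = - u`[n]. Proof. by []. Qed.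
Lemma coefDfps u v n : (u + v)`[n] = u`[n] + v`[n]. Proof. by []. Qed.
Lemma coefBfps u v n : (u - v)`[n] = u`[n] - v`[n]. Proof. by []. Qed.
Lemma coef_sumfps (I : Type) (r : seq I) (P : pred I) (F : I -> fps R) n :
  (\sum_(i <- r | P i) F i)`[n] = \sum_(i <- r | P i) (F i)`[n].
Proof. by elim/big_rec2: _ => // i x u _ <-. Qed.

End FpsZmodule.

Section FpsRing.
Context {R : comNzRingType}.
Implicit Types u v w : fps R.

Definition fps_one : fps R := FPS (fun n => (n == 0%N)%:R).
Definition fps_mul u v : fps R :=
  FPS (fun n => \sum_(i < n.+1) u`[i] * v`[n - i]).

Definition fps_trunc N u : {poly R} := \poly_(i < N) u`[i].

Let mulE (p q : {poly R}) u v n :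
    (forall i, (i <= n)%N -> p`_i = u`[i]) ->
    (forall i, (i <= n)%N -> q`_i = v`[i]) ->
  (fps_mul u v)`[n] = (p * q)`_n.
Proof.
move=> eq_pu eq_qv; rewrite coefM /=; apply: eq_bigr => i _.
by rewrite eq_pu ?eq_qv ?leq_subr // -ltnS.
Qed.

Let truncE N u i : (i < N)%N -> (fps_trunc N u)`_i = u`[i].
Proof. by move=> ltiN; rewrite coef_poly ltiN. Qed.

Fact fps_mulC : commutative fps_mul.
Proof.
move=> u v; apply/fpsP => n; pose T := fps_trunc n.+1.
rewrite (mulE (p := T u) (q := T v)) 1?(mulE (p := T v) (q := T u)) 1?mulrC //.
all: by move=> i lein; apply: truncE.
Qed.

Fact fps_mulA : associative fps_mul.
Proof.
move=> u v w; apply/fpsP => n; pose T := fps_trunc n.+1.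
have TE x i : (i <= n)%N -> (T x)`_i = x`[i] by move=> ?; apply: truncE.
have TM x y i : (i <= n)%N -> (T x * T y)`_i = (fps_mul x y)`[i].
  by move=> lein; rewrite (mulE (p := T x) (q := T y)) => [|j leji|j leji] //; apply: TE;
     apply: leq_trans lein.
rewrite (mulE (p := T u) (q := T v * T w)) => [|i|i]; [|exact: TE|exact: TM].
rewrite (mulE (p := T u * T v) (q := T w)) => [|i|i]; [|exact: TM|exact: TE].
by rewrite mulrA.
Qed.

Fact fps_mul1 : left_id fps_one fps_mul.
Proof.
move=> u; apply/fpsP => n /=; rewrite big_ord_recl /= mul1r subn0.
by rewrite big1 ?addr0 // => i _; rewrite mul0r.
Qed.

Fact fps_mulDl : left_distributive fps_mul +%R.
Proof.
move=> u v w; apply/fpsP => n /=; rewrite -big_split /=.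
by apply: eq_bigr => i _; rewrite mulrDl.
Qed.

Fact fps_one_neq0 : fps_one != 0.
Proof.
by apply/eqP => /fpsP/(_ 0%N)/eqP; rewrite coef0fps /= oner_eq0.
Qed.

HB.instance Definition _ := GRing.Zmodule_isComNzRing.Build (fps R)
  fps_mulA fps_mulC fps_mul1 fps_mulDl fps_one_neq0.

Lemma coef1fps n : (1 : fps R)`[n] = (n == 0%N)%:R. Proof. by []. Qed.
Lemma coefMfps u v n :
  (u * v)`[n] = \sum_(i < n.+1) u`[i] * v`[n - i].
Proof. by []. Qed.

Lemma coef0Mfps u v : (u * v)`[0] = u`[0] * v`[0].
Proof. by rewrite coefMfps big_ord1. Qed.

Lemma coefX_eq0 u k n : u`[0] = 0 -> (n < k)%N -> (u ^+ k)`[n] = 0.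
Proof.
move=> u0; elim: k n => // k IHk n ltnk; rewrite exprS coefMfps.
rewrite big_ord_recl u0 mul0r add0r big1 // => i _.
rewrite IHk ?mulr0 //=; apply: leq_trans (ltnk : (n <= k)%N).
by rewrite /bump add1n ltn_subrL (leq_ltn_trans (leq0n i) (ltn_ord i)).
Qed.

End FpsRing.

Section FpsUnitRing.
Context {R : comUnitRingType}.
Implicit Types u v w : fps R.

Definition fps_unit : {pred fps R} := fun u => u`[0] \is a GRing.unit.

(* For w := 1 - u / u_0 we have w_0 = 0 and u^-1 = u_0^-1 * \sum_k w^k; only  *)
(* the powers k <= n contribute to the coefficient of q^n.                    *)
Definition fps_inv u : fps R :=
  if u \in fps_unit then
    let w := 1 - FPS (fun n => u`[0]^-1 * u`[n]) in
    FPS (fun n => u`[0]^-1 * \sum_(k < n.+1) (w ^+ k)`[n])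
  else u.

Fact fps_mulVr : {in fps_unit, left_inverse 1 fps_inv *%R}.
Proof.
move=> u uU; rewrite /fps_inv uU; set w := 1 - _.
have u0U : u`[0] \is a GRing.unit by [].
have w0 : w`[0] = 0 by rewrite coefBfps /= mulVr // subrr.
apply/fpsP => n; pose G : fps R := \sum_(k < n.+1) w ^+ k.
transitivity ((G * (1 - w))`[n]); last first.
  rewrite mulrC -opprB mulNr -subrX1 coefNfps coefBfps coefX_eq0 //.
  by rewrite sub0r opprK.
rewrite !coefMfps; apply: eq_bigr => i _ /=.
have -> : G`[i] = \sum_(k < i.+1) (w ^+ k)`[i].
  rewrite coef_sumfps [RHS](big_ord_widen n.+1 (fun k => (w ^+ k)`[i])) //.
  rewrite [RHS]big_mkcond; apply: eq_bigr => k _.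
  by case: ltnP => // ltik; rewrite coefX_eq0.
by rewrite /w subKr /= mulrCA mulrA.
Qed.

Fact fps_unitPl u v : v * u = 1 -> fps_unit u.
Proof.
move/fpsP/(_ 0%N); rewrite coef0Mfps coef1fps => vu1.
by apply/unitrP; exists v`[0]; split=> //; rewrite mulrC.
Qed.

Fact fps_inv_out : {in [predC fps_unit], fps_inv =1 id}.
Proof. by move=> u; rewrite inE /fps_inv /= => /negbTE ->. Qed.

HB.instance Definition _ := GRing.ComNzRing_hasMulInverse.Build (fps R)
  fps_mulVr fps_unitPl fps_inv_out.

Lemma fps_unitE u : (u \is a GRing.unit) = (u`[0] \is a GRing.unit).
Proof. by []. Qed.

End FpsUnitRing.

Arguments fps_coef : simpl never.

Section InfiniteProducts.
Context {R : comNzRingType}.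
Implicit Types (u v : nat -> fps R) (P Q a q : fps R).

Definition fpsX : fps R := FPS (fun n => (n == 1%N)%:R).

(* Convergence of the partial products in the X-adic topology.                *)
Definition infprod_cvg u P : Prop :=
  forall n, exists N, forall m, (N <= m)%N -> (\prod_(k < m) u k)`[n] = P`[n].

Definition infprod u : fps R := xget 0 [set P | infprod_cvg u P].

(* (a; q)_oo                                                                  *)
Definition qpoch a q : fps R := infprod (fun k => 1 - a * q ^+ k).

Lemma infprod_cvg_unique u P Q : infprod_cvg u P -> infprod_cvg u Q -> P = Q.
Proof.
move=> uP uQ; apply/fpsP => n; have [[N NP] [M MQ]] := (uP n, uQ n).
by rewrite -(NP (maxn N M)) ?leq_maxl // -(MQ (maxn N M)) ?leq_maxr.
Qed.

Lemma infprodE u P : infprod_cvg u P -> infprod u = P.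
Proof.
move=> uP; rewrite /infprod (xget_unique 0 uP) // => Q uQ.
exact: infprod_cvg_unique uQ uP.
Qed.

Lemma coef_fpsXn k n : (fpsX ^+ k)`[n] = (n == k)%:R.
Proof.
elim: k n => // k IHk [|n]; first by rewrite exprS coef0Mfps mul0r.
rewrite exprS coefMfps big_ord_recl mul0r add0r big_ord_recl big1 => [|i _].
  by rewrite addr0 mul1r IHk subSS subn0.
by rewrite mul0r.
Qed.

Lemma qpoch_cvg (a b : nat) : (0 < a)%N -> (0 < b)%N ->
  infprod_cvg (fun k => 1 - fpsX ^+ a * (fpsX ^+ b) ^+ k)
    (qpoch (fpsX ^+ a) (fpsX ^+ b)).
Proof.
move=> a0 b0; rewrite /qpoch.
set u : nat -> fps R := fun k => 1 - fpsX ^+ a * (fpsX ^+ b) ^+ k.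
pose P : fps R := FPS (fun n => (\prod_(k < n) u k)`[n]).
suff uP : infprod_cvg u P by rewrite (infprodE uP).
move=> n; exists n; elim=> [|m IHm]; first by rewrite leqn0 => /eqP->.
rewrite leq_eqVlt => /orP[/eqP-> //|]; rewrite ltnS => lenm.
have uE : u m = 1 - fpsX ^+ (a + b * m) by rewrite /u -exprM -exprD.
rewrite big_ord_recr /= uE mulrBr mulr1 coefBfps (IHm lenm) coefMfps big1 ?subr0 // => i _.
suff /negbTE nk : (n - i != a + b * m)%N by rewrite coef_fpsXn nk mulr0.
rewrite neq_ltn.
rewrite (leq_ltn_trans (leq_subr _ _)) // (leq_ltn_trans lenm) //.
by rewrite -[m.+1]add1n leq_add // leq_pmull.
Qed.

Lemma qpoch_coef0 (a b : nat) : (0 < a)%N -> (0 < b)%N ->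
  (qpoch (fpsX ^+ a) (fpsX ^+ b))`[0] = 1.
Proof.
move=> a0 b0; have [N /(_ N (leqnn N)) <-] := qpoch_cvg a0 b0 0%N.
elim/big_ind: _ => // [u v u0 v0|k _]; first by rewrite coef0Mfps u0 v0 mulr1.
rewrite -exprM -exprD coefBfps coef_fpsXn.
by case: a a0 => // a _; rewrite addSn subr0.
Qed.

End InfiniteProducts.

Arguments fpsX {R}.

Lemma qpoch_unit (R : comUnitRingType) (a b : nat) : (0 < a)%N -> (0 < b)%N ->
  (qpoch (fpsX ^+ a) (fpsX ^+ b) : fps R) \is a GRing.unit.
Proof. by move=> a0 b0; rewrite fps_unitE qpoch_coef0 ?unitr1. Qed.

Definition f (r : nat) : fps int := qpoch (fpsX ^+ r) (fpsX ^+ r).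

Definition schur_gf : fps int :=
  1 / (qpoch fpsX (fpsX ^+ 6) * qpoch (fpsX ^+ 5) (fpsX ^+ 6)
       * qpoch (fpsX ^+ 6) (fpsX ^+ 6)).

(* S(n), the number of overpartitions of n of Schur type                      *)
Definition schur_overpartitions (n : nat) : int := schur_gf`[n].

Lemma schur_overpartitions_gf : FPS schur_overpartitions = schur_gf.
Proof. by apply/fpsP. Qed.

Lemma f_unit (r : nat) : (0 < r)%N -> f r \is a GRing.unit.
Proof. by move=> r0; apply: qpoch_unit. Qed.

Lemma schur_gfE :
  schur_gf * (qpoch fpsX (fpsX ^+ 6) * qpoch (fpsX ^+ 5) (fpsX ^+ 6)
              * qpoch (fpsX ^+ 6) (fpsX ^+ 6)) = 1.
Proof.
rewrite /schur_gf divrK // !unitrM !qpoch_unit //.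
by rewrite (@qpoch_unit _ 1 6).
Qed.

(* Main.v *)
Require Import Defs.
From HB Require Import structures.
From mathcomp Require Import all_boot all_order all_algebra.
From mathcomp Require Import boolp classical_sets filter nat_topology.
From mathcomp Require Import ring zify.

(* Write (-q, -q^5, q^6; q^6)_oo as the theta series of the exponents 3n^2 + 2n,
   by the Jacobi triple product. Up to a factor that is even in q, it is the
   generating function of S. The parity of 3n^2 + 2n is that of n, so the even
   and the odd n yield the even and the odd part of the generating function;
   each of them is again a theta series, which the triple product turns back
   into a product. The triple product itself is the limit of a finite identity
   between Gaussian binomials, proved by induction from the q-binomial
   theorem. *)

Set Implicit Arguments.
Unset Strict Implicit.
Unset Printing Implicit Defensive.

Import GRing.Theory.

Local Open Scope classical_set_scope.
Local Open Scope ring_scope.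

Section FiniteSums.
Context {V : nmodType}.
Implicit Types (E : nat -> V) (n : nat).

Lemma sum_even_odd E n :
  \sum_(i < 2 * n) E i = \sum_(i < n) E (2 * i)%N + \sum_(i < n) E (2 * i).+1.
Proof.
elim: n => [|n IHn]; first by rewrite !big_ord0 addr0.
rewrite mulnS !addSn add0n !big_ord_recr /= IHn -!addrA; congr (_ + _).
by rewrite addrCA.
Qed.

Lemma sum_ord_centered E n :
  \sum_(j < (n + n).+1) E j
  = \sum_(i < n.+1) E (n + i)%N + \sum_(i < n) E (n - i.+1)%N.
Proof.
rewrite -addnS big_split_ord /= addrC; congr (_ + _).
exact: reindex_inj rev_ord_inj.
Qed.

End FiniteSums.

Section FiniteQPochhammer.
Context {R : comNzRingType}.
Implicit Types (q x : R) (d n : nat).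

Definition qpochn x q n : R := \prod_(k < n) (1 - x * q ^+ k).

Lemma qpochnS x q n : qpochn x q n.+1 = qpochn x q n * (1 - x * q ^+ n).
Proof. exact: big_ord_recr. Qed.

Lemma qpochnSl x q n : qpochn x q n.+1 = (1 - x) * qpochn (x * q) q n.
Proof.
rewrite /qpochn big_ord_recl mulr1; congr (_ * _).
by apply: eq_bigr => k _; rewrite exprS mulrA.
Qed.

Lemma qpochnMN x q n :
  qpochn x q n * qpochn (- x) q n = qpochn (x ^+ 2) (q ^+ 2) n.
Proof.
rewrite -big_split; apply: eq_bigr => k _ /=.
by rewrite -exprM mulnC exprM; ring.
Qed.

Lemma qpochn_dissection x q d n :
  qpochn x q (d * n) = \prod_(j < d) qpochn (x * q ^+ j) (q ^+ d) n.
Proof.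
elim: n => [|n IHn].
  by rewrite muln0 /qpochn big_ord0 big1 // => j _; rewrite big_ord0.
rewrite mulnS addnC /qpochn big_split_ord /= -/(qpochn x q (d * n)) IHn.
rewrite -big_split; apply: eq_bigr => j _ /=; rewrite -/(qpochn _ _ _) qpochnS.
by congr (_ * (1 - _)); rewrite exprD exprM; ring.
Qed.

End FiniteQPochhammer.

Section GaussianBinomials.
Context {R : comNzRingType}.
Implicit Types (q x : R) (j m n : nat).

Fixpoint gauss q n j : R :=
  match n, j with
  | _, 0 => 1
  | 0, _.+1 => 0
  | n'.+1, j'.+1 => gauss q n' j' + q ^+ j'.+1 * gauss q n' j'.+1
  end.

Arguments gauss : simpl never.

Lemma gauss0 q n : gauss q n 0 = 1. Proof. by case: n. Qed.

Lemma gaussS q n j :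
  gauss q n.+1 j.+1 = gauss q n j + q ^+ j.+1 * gauss q n j.+1.
Proof. by []. Qed.

Lemma gauss_small q n j : (n < j)%N -> gauss q n j = 0.
Proof.
elim: n j => [|n IHn] [|j] //; rewrite ltnS => ltnj.
by rewrite gaussS !IHn ?mulr0 ?addr0 // ltnW.
Qed.

Lemma gauss_diag q n : gauss q n n = 1.
Proof.
by elim: n => // n IHn; rewrite gaussS IHn gauss_small // mulr0 addr0.
Qed.

Lemma gauss_qpochn q m n :
  gauss q (m + n) m * (qpochn q q m * qpochn q q n) = qpochn q q (m + n).
Proof.
have qpochn0 : qpochn q q 0 = 1 by rewrite /qpochn big_ord0.
elim: m n => [|m IHm] n; first by rewrite gauss0 qpochn0 !mul1r.
elim: n => [|n IHn]; first by rewrite addn0 gauss_diag qpochn0 mul1r mulr1.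
have {}IHm := IHm n.+1; rewrite addnS in IHm; rewrite addSn in IHn.
rewrite addSn addnS gaussS [RHS]qpochnS mulrBr mulr1.
transitivity ((1 - q * q ^+ m) * qpochn q q (m + n).+1
  + q ^+ m.+1 * (1 - q * q ^+ n) * qpochn q q (m + n).+1).
  by rewrite -{1}IHm -IHn !qpochnS; ring.
by rewrite !exprS exprD; ring.
Qed.

Lemma sum_gaussS q (F : nat -> R) n :
  \sum_(j < n.+2) F j * gauss q n.+1 j
  = \sum_(j < n.+1) (F j.+1 + F j * q ^+ j) * gauss q n j.
Proof.
under [RHS]eq_bigr do rewrite mulrDl -mulrA.
rewrite [RHS]big_split /= [X in _ = _ + X]big_ord_recl gauss0 mulr1.
rewrite [LHS]big_ord_recl gauss0 mulr1 [RHS]addrCA; congr (_ + _).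
under [LHS]eq_bigr do rewrite lift0 gaussS mulrDr.
rewrite big_split /= [X in _ + X = _]big_ord_recr /= gauss_small //.
by rewrite !mulr0 addr0.
Qed.

Lemma gauss_binomial q x n :
  qpochn (- x) q n = \sum_(j < n.+1) x ^+ j * q ^+ 'C(j, 2) * gauss q n j.
Proof.
elim: n x => [|n IHn] x.
  by rewrite /qpochn big_ord0 big_ord1 bin_small // !mulr1.
rewrite qpochnSl mulNr IHn mulr_sumr.
rewrite (sum_gaussS q (fun j => x ^+ j * q ^+ 'C(j, 2))).
apply: eq_bigr => j _; rewrite binS bin1 exprD exprMn !exprS; ring.
Qed.

End GaussianBinomials.

Section ThetaTerms.
Context {R : comNzRingType}.
Implicit Types (x y z : R) (i : int) (j m n : nat).

Definition triangle i : nat := let: (Posz n | Negz n) := i in 'C(n.+1, 2).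

Lemma triangleE i : 2 * (triangle i)%:Z = i * (i + 1).
Proof.
by case: i => n /=; have := mul_bin_diag n.+1 1; rewrite bin1; lia.
Qed.

Definition theta_term x y i : R := x ^+ triangle i * y ^+ triangle (- i).

Lemma theta_termN x y i : theta_term x y (- i) = theta_term y x i.
Proof. by rewrite /theta_term opprK mulrC. Qed.

Lemma theta_term_nat x y n :
  theta_term x y n = (x * y) ^+ 'C(n, 2) * x ^+ n.
Proof.
have -> : theta_term x y n = x ^+ ('C(n, 2) + n) * y ^+ 'C(n, 2).
  congr (_ ^+ _ * _ ^+ _); first by rewrite /= binS bin1.
  by case: n => // n; rewrite NegzE.
by rewrite exprD exprMn; ring.
Qed.

Lemma theta_termB1 x y j n :
  theta_term x y (j%:Z - n%:Z) * (y * (x * y) ^+ n)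
  = theta_term x y (j%:Z - n.+1%:Z) * (x * y) ^+ j.
Proof.
have xE : (triangle (j%:Z - n%:Z) + n = triangle (j%:Z - n.+1%:Z) + j)%N.
  by have := triangleE (j%:Z - n%:Z); have := triangleE (j%:Z - n.+1%:Z); lia.
have yE : (triangle (- (j%:Z - n%:Z)) + n.+1
           = triangle (- (j%:Z - n.+1%:Z)) + j)%N.
  have := triangleE (- (j%:Z - n%:Z)).
  by have := triangleE (- (j%:Z - n.+1%:Z)); lia.
rewrite /theta_term !exprMn [y * _]mulrCA -exprS mulrACA -!exprD xE yE.
by rewrite !exprD mulrACA.
Qed.

Lemma theta_term_even x y i :
  theta_term x y (2 * i) = theta_term (x ^+ 3 * y) (x * y ^+ 3) i.
Proof.
have xE : triangle (2 * i) = (3 * triangle i + triangle (- i))%N.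
  have := triangleE (2 * i).
  by have := triangleE i; have := triangleE (- i); lia.
have yE : triangle (- (2 * i)) = (triangle i + 3 * triangle (- i))%N.
  have := triangleE (- (2 * i)).
  by have := triangleE i; have := triangleE (- i); lia.
by rewrite /theta_term xE yE !exprD !exprMn; ring.
Qed.

Lemma theta_term_odd x z i :
  theta_term x (x * z) (2 * i + 1) = x * theta_term (x ^+ 8 * z ^+ 3) z i.
Proof.
have xE : (triangle (2 * i + 1) + triangle (- (2 * i + 1))
           = (8 * triangle i).+1)%N.
  have := triangleE (2 * i + 1); have := triangleE (- (2 * i + 1)).
  by have := triangleE i; lia.
have zE : triangle (- (2 * i + 1)) = (3 * triangle i + triangle (- i))%N.
  have := triangleE (- (2 * i + 1)).
  by have := triangleE i; have := triangleE (- i); lia.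
rewrite /theta_term exprMn [LHS]mulrA -exprD xE zE exprS !exprD !exprMn; ring.
Qed.

Lemma finite_triple_product x y m n :
  qpochn (- x) (x * y) m * qpochn (- y) (x * y) n
  = \sum_(j < (n + m).+1)
      theta_term x y (j%:Z - n%:Z) * gauss (x * y) (n + m) j.
Proof.
elim: n => [|n IHn].
  rewrite [X in _ * X]big_ord0 mulr1 gauss_binomial.
  by apply: eq_bigr => j _; rewrite subr0 theta_term_nat [X in X * _]mulrC.
rewrite qpochnS mulrA IHn mulr_suml.
rewrite (sum_gaussS _ (fun j => theta_term x y (j%:Z - n.+1%:Z))).
apply: eq_bigr => j _; rewrite -theta_termB1.
rewrite (_ : j.+1%:Z - n.+1%:Z = j%:Z - n%:Z); last by lia.
by ring.
Qed.

End ThetaTerms.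

Section Convergence.
Context {R : comNzRingType}.
Implicit Types (u v F G : nat -> fps R) (a b c l : fps R) (k m n : nat).

Lemma coefM_eq0 a b n : (forall i, (i <= n)%N -> a`[i] = 0) -> (a * b)`[n] = 0.
Proof.
by move=> a0; rewrite coefMfps big1 // => i _; rewrite a0 ?mul0r // -ltnS.
Qed.

Definition fps_cvg u l : Prop :=
  forall n, \forall m \near \oo, (u m)`[n] = l`[n].

Lemma fps_cvg_le u l n : fps_cvg u l ->
  \forall m \near \oo, forall i, (i <= n)%N -> (u m)`[i] = l`[i].
Proof.
move=> ul; apply: filterS (filter_forall _ (fun i : 'I_n.+1 => ul i)).
by move=> m ulm i le_in; apply: (ulm (Ordinal (le_in : i < n.+1)%N)).
Qed.

Lemma fps_cvg_unique u l l' : fps_cvg u l -> fps_cvg u l' -> l = l'.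
Proof.
move=> ul ul'; apply/fpsP => n.
by have [m [<- <-]] := filter_ex (filterI (ul n) (ul' n)).
Qed.

Lemma fps_cvg_cst l : fps_cvg (fun=> l) l.
Proof. by move=> n; apply: nearW. Qed.

Lemma near_eq_fps_cvg u v l :
  (\forall m \near \oo, u m = v m) -> fps_cvg u l -> fps_cvg v l.
Proof. by move=> uv ul n; move: uv (ul n); apply: filterS2 => m <-. Qed.

Lemma eq_fps_cvg u v l : u =1 v -> fps_cvg u l -> fps_cvg v l.
Proof. by move=> /funext->. Qed.

Lemma fps_cvg_comp u l (h : nat -> nat) :
  fps_cvg u l -> h @ \oo --> \oo -> fps_cvg (u \o h) l.
Proof. by move=> ul hoo n; apply: (hoo _ (ul n)). Qed.

Lemma fps_cvgD u v a b :
  fps_cvg u a -> fps_cvg v b -> fps_cvg (fun m => u m + v m) (a + b).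
Proof.
move=> ua vb n; move: (ua n) (vb n).
by apply: filterS2 => m uam vbm; rewrite !coefDfps uam vbm.
Qed.

Lemma fps_cvgB u v a b :
  fps_cvg u a -> fps_cvg v b -> fps_cvg (fun m => u m - v m) (a - b).
Proof.
move=> ua vb n; move: (ua n) (vb n).
by apply: filterS2 => m uam vbm; rewrite !coefBfps uam vbm.
Qed.

Lemma fps_cvgM u v a b :
  fps_cvg u a -> fps_cvg v b -> fps_cvg (fun m => u m * v m) (a * b).
Proof.
move=> ua vb n; move: (fps_cvg_le n ua) (fps_cvg_le n vb).
apply: filterS2 => m uam vbm; rewrite !coefMfps; apply: eq_bigr => i _.
by rewrite uam ?vbm ?leq_subr // -ltnS.
Qed.

Lemma fps_cvg0M u v : fps_cvg u 0 -> fps_cvg (fun m => u m * v m) 0.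
Proof.
by move=> u0 n; apply: filterS (fps_cvg_le n u0) => m; apply: coefM_eq0.
Qed.

Lemma fps_cvg_prod k (w : nat -> nat -> fps R) (z : nat -> fps R) :
    (forall j, fps_cvg (w j) (z j)) ->
  fps_cvg (fun m => \prod_(j < k) w j m) (\prod_(j < k) z j).
Proof.
move=> wz; elim: k => [|k IHk].
  rewrite big_ord0; apply: eq_fps_cvg (fps_cvg_cst 1) => m.
  by rewrite big_ord0.
rewrite big_ord_recr; apply: eq_fps_cvg (fps_cvgM IHk (wz k)) => m.
by rewrite big_ord_recr.
Qed.

Lemma fps_expr_cvg0 a (h : nat -> nat) :
  a`[0] = 0 -> h @ \oo --> \oo -> fps_cvg (fun m => a ^+ h m) 0.
Proof.
move=> a0 hoo n; have : \forall m \near \oo, (n < h m)%N.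
  exact: hoo _ (nbhs_infty_gt n).
by apply: filterS => m; apply: coefX_eq0.
Qed.

(* The X-adic metric is nonarchimedean, so vanishing increments suffice.      *)
Lemma fps_is_cvg_increments u :
  fps_cvg (fun m => u m.+1 - u m) 0 -> exists l, fps_cvg u l.
Proof.
move=> du; have /choice[N uN] n :
    exists N, forall m, (N <= m)%N -> (u m)`[n] = (u N)`[n].
  have [N _ duN] := du n; exists N; elim=> [|m IHm].
    by rewrite leqn0 => /eqP->.
  rewrite leq_eqVlt => /predU1P[<- //|le_Nm]; rewrite -IHm //.
  by apply/eqP; rewrite -subr_eq0 -coefBfps duN.
by exists (FPS (fun n => (u (N n))`[n])) => n; exists (N n) => //; apply: uN.
Qed.

Lemma infprod_cvgE u a :
  infprod_cvg u a <-> fps_cvg (fun m => \prod_(k < m) u k) a.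
Proof.
by split=> ua n; [have [N uN] := ua n | have [N _ uN] := ua n]; exists N.
Qed.

Lemma infprod_cvgP u :
  fps_cvg u 1 -> fps_cvg (fun m => \prod_(k < m) u k) (infprod u).
Proof.
move=> u1; have /fps_is_cvg_increments[l ul] : fps_cvg
    (fun m => \prod_(k < m.+1) u k - \prod_(k < m) u k) 0.
  have := fps_cvgB u1 (fps_cvg_cst 1); rewrite subrr => u1_0.
  apply: eq_fps_cvg (fps_cvg0M (fun m => \prod_(k < m) u k) u1_0) => m.
  by rewrite big_ord_recr mulrBl mul1r mulrC.
by rewrite (infprodE (proj2 (infprod_cvgE _ _) ul)).
Qed.

Definition fps_series F : fps R :=
  xget 0 [set S | fps_cvg (fun m => \sum_(n < m) F n) S].

Lemma fps_series_cvg F :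
  fps_cvg F 0 -> fps_cvg (fun m => \sum_(n < m) F n) (fps_series F).
Proof.
move=> F0; have /fps_is_cvg_increments[S FS] : fps_cvg
    (fun m => \sum_(n < m.+1) F n - \sum_(n < m) F n) 0.
  by apply: eq_fps_cvg F0 => m; rewrite big_ord_recr addrC addKr.
rewrite /fps_series (xget_unique 0 FS) // => S' FS'.
exact: fps_cvg_unique FS' FS.
Qed.

Lemma fps_seriesM c F :
  fps_cvg F 0 -> fps_series (fun n => c * F n) = c * fps_series F.
Proof.
move=> F0; have cF0 : fps_cvg (fun n => c * F n) 0.
  by apply: eq_fps_cvg (fps_cvg0M (fun=> c) F0) => n; rewrite mulrC.
apply: fps_cvg_unique (fps_series_cvg cF0) _.
apply: eq_fps_cvg (fps_cvgM (fps_cvg_cst c) (fps_series_cvg F0)) => m.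
by rewrite mulr_sumr.
Qed.

Lemma fps_series_even_odd F : fps_cvg F 0 ->
  fps_series F
  = fps_series (fun n => F (2 * n)%N) + fps_series (fun n => F (2 * n).+1).
Proof.
move=> F0; have double_oo := cvg_mulnl 2 isT.
have F0_even := fps_cvg_comp F0 double_oo.
have F0_odd : fps_cvg (fun n => F (2 * n).+1) 0.
  exact: fps_cvg_comp (fps_cvg_comp F0 (cvg_addnl 1)) double_oo.
apply: fps_cvg_unique (fps_cvg_comp (fps_series_cvg F0) double_oo) _.
have := fps_cvgD (fps_series_cvg F0_even) (fps_series_cvg F0_odd).
by apply: eq_fps_cvg => m; rewrite /= sum_even_odd.
Qed.

Lemma fps_series_tannery F (c : nat -> nat -> fps R) (C : nat -> fps R)
    (h : nat -> nat) :
    fps_cvg F 0 -> (forall n, fps_cvg (c^~ n) (C n)) -> h @ \oo --> \oo ->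
  fps_cvg (fun m => \sum_(n < h m) F n * c m n)
    (fps_series (fun n => F n * C n)).
Proof.
move=> F0 cC hoo k; have [N _ F0N] := fps_cvg_le k F0.
have := fps_cvg_comp (fps_series_cvg (fps_cvg0M C F0)) hoo k.
have := filter_forall eventually_filter (fun n : 'I_N => fps_cvg_le k (cC n)).
apply: filterS2 => m cm <- /=; rewrite !coef_sumfps; apply: eq_bigr => n _.
have [lt_nN|le_Nn] := ltnP n N; last by rewrite !coefM_eq0 //; apply: F0N.
rewrite !coefMfps; apply: eq_bigr => i _.
by rewrite (cm (Ordinal lt_nN)) ?leq_subr.
Qed.

End Convergence.

Section BilateralSeries.
Context {R : comNzRingType}.
Implicit Types (F : int -> fps R) (c : fps R) (n : nat).

Definition fps_bsummable F : Prop :=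
  fps_cvg (fun n => F n%:Z) 0 /\ fps_cvg (fun n => F (Negz n)) 0.

Definition fps_bseries F : fps R :=
  fps_series (fun n => F n%:Z) + fps_series (fun n => F (Negz n)).

Lemma fps_bseriesM c F :
  fps_bsummable F -> fps_bseries (fun i => c * F i) = c * fps_bseries F.
Proof. by case=> posF0 negF0; rewrite /fps_bseries !fps_seriesM // mulrDr. Qed.

Lemma fps_bseries_even_odd F : fps_bsummable F ->
  fps_bseries F
  = fps_bseries (fun i => F (2 * i)) + fps_bseries (fun i => F (2 * i + 1)).
Proof.
case=> posF0 negF0; rewrite /fps_bseries (fps_series_even_odd posF0).
rewrite (fps_series_even_odd negF0) [X in _ + X]addrC addrACA.
by congr (fps_series _ + fps_series _ + (fps_series _ + fps_series _));
  apply/funext => n; congr F; lia.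
Qed.

End BilateralSeries.

Section ConvergenceInverse.
Context {R : comUnitRingType}.

Lemma fps_cvgV (u : nat -> fps R) (l : fps R) :
    (forall m, u m \is a GRing.unit) -> l \is a GRing.unit ->
  fps_cvg u l -> fps_cvg (fun m => (u m)^-1) l^-1.
Proof.
move=> uU lU ul; have := fps_cvgB (fps_cvg_cst l) ul; rewrite subrr => lu0.
have := fps_cvgD (fps_cvg_cst l^-1) (fps_cvg0M (fun m => (l * u m)^-1) lu0).
rewrite addr0; apply: eq_fps_cvg => m.
rewrite invrM // mulrBl mulrCA divrr // mulr1.
by rewrite mulrA divrr // mul1r addrC subrK.
Qed.

End ConvergenceInverse.

Section QPochhammerLimits.
Context {R : comNzRingType}.
Implicit Types (x q : fps R) (d : nat).

Lemma qpochn_cvg x q : q`[0] = 0 -> fps_cvg (qpochn x q) (qpoch x q).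
Proof.
move=> q0; apply: infprod_cvgP.
have qX0 : fps_cvg (fun k => q ^+ k * x) 0.
  by apply/fps_cvg0M/fps_expr_cvg0; last exact: cvg_id.
have := fps_cvgB (fps_cvg_cst 1) qX0; rewrite subr0.
by apply: eq_fps_cvg => k; rewrite mulrC.
Qed.

Lemma coef0Xfps q n : q`[0] = 0 -> (0 < n)%N -> (q ^+ n)`[0] = 0.
Proof. exact: coefX_eq0. Qed.

Lemma qpochMN x q : q`[0] = 0 ->
  qpoch x q * qpoch (- x) q = qpoch (x ^+ 2) (q ^+ 2).
Proof.
move=> q0; have := qpochn_cvg (x ^+ 2) (coef0Xfps q0 (ltn0Sn 1)).
apply: fps_cvg_unique.
have := fps_cvgM (qpochn_cvg x q0) (qpochn_cvg (- x) q0).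
by apply: eq_fps_cvg; apply: qpochnMN.
Qed.

Lemma qpoch_dissection x q d : q`[0] = 0 -> (0 < d)%N ->
  qpoch x q = \prod_(j < d) qpoch (x * q ^+ j) (q ^+ d).
Proof.
move=> q0 d0; have := fps_cvg_prod d
  (fun j => qpochn_cvg (x * q ^+ j) (coef0Xfps q0 d0)).
apply: fps_cvg_unique.
apply: eq_fps_cvg (fps_cvg_comp (qpochn_cvg x q0) (cvg_mulnl d d0)) => m.
exact: qpochn_dissection.
Qed.

End QPochhammerLimits.

Section Theta.
Context {R : comNzRingType}.
Implicit Types (x y z : fps R).

(* Ramanujan's f(x, y), the sum of x^(i(i+1)/2) y^(i(i-1)/2) over i in Z.     *)
Definition theta x y : fps R := fps_bseries (theta_term x y).

Lemma cvg_bin2 : binomial^~ 2 @ \oo --> \oo.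
Proof.
apply/cvgnyPge => A; exists A.+1 => // -[|m] //= lt_Am.
by rewrite binS bin1 (leq_trans _ (leq_addl _ _)).
Qed.

Lemma theta_summable x y :
  (x * y)`[0] = 0 -> fps_bsummable (theta_term x y).
Proof.
have cvg0 (a b : fps R) :
    (a * b)`[0] = 0 -> fps_cvg (fun n => theta_term a b n%:Z) 0.
  move=> ab0; have := fps_cvg0M (fun n => a ^+ n) (fps_expr_cvg0 ab0 cvg_bin2).
  by apply: eq_fps_cvg => n; rewrite theta_term_nat.
move=> xy0; split; first exact: cvg0.
rewrite mulrC in xy0.
apply: eq_fps_cvg (fps_cvg_comp (cvg0 _ _ xy0) (cvg_addnl 1)) => n.
by rewrite NegzE theta_termN.
Qed.

(* Ramanujan's f(x, y) = f(x^3 y, x y^3) + x f(y / x, x^5 y^3) at y = x z.    *)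
Lemma theta_dissection x z : (x ^+ 2 * z)`[0] = 0 ->
  theta x (x * z)
  = theta (x ^+ 4 * z) (x ^+ 4 * z ^+ 3) + x * theta (x ^+ 8 * z ^+ 3) z.
Proof.
move=> xz0; have sum1 : fps_bsummable (theta_term x (x * z)).
  by apply: theta_summable; rewrite mulrA.
have sum2 : fps_bsummable (theta_term (x ^+ 8 * z ^+ 3) z).
  apply: theta_summable; rewrite (_ : _ * _ = (x ^+ 2 * z) ^+ 4); last by ring.
  exact: coef0Xfps.
rewrite /theta (fps_bseries_even_odd sum1) -(fps_bseriesM x sum2).
congr (fps_bseries _ + fps_bseries _); apply/funext => i.
  by rewrite theta_term_even; congr (theta_term _ _ _); ring.
exact: theta_term_odd.
Qed.

End Theta.

Section TripleProduct.
Context {R : comUnitRingType}.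
Implicit Types (x y q : fps R) (n : nat).

Lemma qpochn_unit x q n : x`[0] = 0 -> qpochn x q n \is a GRing.unit.
Proof.
move=> x0; apply: rpred_prod => k _; rewrite fps_unitE coefBfps coef0Mfps x0.
by rewrite mul0r subr0 unitr1.
Qed.

Lemma qpoch_unit_coef0 x q :
  x`[0] = 0 -> q`[0] = 0 -> qpoch x q \is a GRing.unit.
Proof.
move=> x0 q0; have [m] := filter_ex (qpochn_cvg x q0 0%N).
by rewrite fps_unitE => <-; rewrite -fps_unitE qpochn_unit.
Qed.

Lemma gauss_cvg q (N i : nat -> nat) : q`[0] = 0 ->
    i @ \oo --> \oo -> (fun m => N m - i m)%N @ \oo --> \oo ->
  fps_cvg (fun m => gauss q (N m) (i m)) (qpoch q q)^-1.
Proof.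
move=> q0 ioo Nioo; have qU := qpoch_unit_coef0 q0 q0.
have qq_cvg := qpochn_cvg q q0.
have qqnU n m : qpochn q q n * qpochn q q m \is a GRing.unit.
  by rewrite unitrM !qpochn_unit.
have Noo : (fun m => i m + (N m - i m))%N @ \oo --> \oo.
  apply/cvgnyPge => A; apply: filterS (proj1 (cvgnyPge i) ioo A) => m le_Ai.
  exact: leq_trans le_Ai (leq_addr _ _).
have -> : (qpoch q q)^-1 = qpoch q q / (qpoch q q * qpoch q q).
  by rewrite invrM // mulrA divrr // mul1r.
have qqU : qpoch q q * qpoch q q \is a GRing.unit by rewrite unitrM qU.
have qqV_cvg := fps_cvgV (fun m => qqnU (i m) (N m - i m)%N) qqU
  (fps_cvgM (fps_cvg_comp qq_cvg ioo) (fps_cvg_comp qq_cvg Nioo)).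
apply: near_eq_fps_cvg (fps_cvgM (fps_cvg_comp qq_cvg Noo) qqV_cvg).
have : \forall m \near \oo, (0 < N m - i m)%N := Nioo _ (nbhs_infty_gt 0).
apply: filterS => m; rewrite subn_gt0 => /ltnW/subnKC NE /=.
by rewrite -gauss_qpochn NE mulrK // qqnU.
Qed.

Lemma jacobi_triple_product x y : (x * y)`[0] = 0 ->
  theta x y
  = qpoch (- x) (x * y) * qpoch (- y) (x * y) * qpoch (x * y) (x * y).
Proof.
move=> q0; set q := x * y; have qU := qpoch_unit_coef0 q0 q0.
have [thetaP thetaN] := theta_summable q0.
have gaussP n : fps_cvg (fun m => gauss q (m + m) (m + n)) (qpoch q q)^-1.
  apply: gauss_cvg => //; first exact: cvg_addnr.
  by apply/cvgnyPge => A; exists (A + n)%N => // m /=; lia.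
have gaussN n : fps_cvg (fun m => gauss q (m + m) (m - n.+1)) (qpoch q q)^-1.
  apply: gauss_cvg => //; first exact: cvg_subnr.
  by apply/cvgnyPge => A; exists A => // m /=; lia.
have : fps_cvg (fun m => qpochn (- x) q m * qpochn (- y) q m)
    ((qpoch q q)^-1 * theta x y).
  have := fps_cvgD (fps_series_tannery thetaP gaussP (cvg_addnl 1))
                   (fps_series_tannery thetaN gaussN cvg_id).
  rewrite mulrDr -!fps_seriesM // -/q.
  under [X in fps_series X + _]funext do rewrite mulrC.
  under [X in _ + fps_series X]funext do rewrite mulrC.
  apply: eq_fps_cvg => m; rewrite finite_triple_product.
  rewrite (sum_ord_centered
    (fun j => theta_term x y (j%:Z - m%:Z) * gauss q (m + m) j)).
  congr (_ + _); apply: eq_bigr => n _; congr (theta_term _ _ _ * _).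
    by rewrite PoszD addrC addKr.
  by move: (nat_of_ord n) (ltn_ord n) => k; lia.
move/(fps_cvg_unique (fps_cvgM (qpochn_cvg _ q0) (qpochn_cvg _ q0))) => ->.
by rewrite mulrC mulVKr.
Qed.

Lemma thetaC x y : (x * y)`[0] = 0 -> theta x y = theta y x.
Proof.
move=> xy0; have yx0 : (y * x)`[0] = 0 by rewrite mulrC.
rewrite (jacobi_triple_product xy0) (jacobi_triple_product yx0) [y * x]mulrC.
by congr (_ * _); apply: mulrC.
Qed.

End TripleProduct.

Section Dilation.
Context {R : comNzRingType} (d : nat).
Implicit Types (a b x q : fps R).

(* The substitution [q := q^d]; for [d = 0] it extracts the constant term.    *)
Definition fps_dilate a : fps R :=
  FPS (fun n => if (d %| n)%N then a`[n %/ d] else 0).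

Lemma coef_dilate a n :
  (fps_dilate a)`[n] = if (d %| n)%N then a`[n %/ d] else 0.
Proof. by []. Qed.

Lemma coef0_dilate a : (fps_dilate a)`[0] = a`[0].
Proof. by rewrite coef_dilate dvdn0 div0n. Qed.

Fact fps_dilate_is_zmod_morphism : zmod_morphism fps_dilate.
Proof.
move=> a b; apply/fpsP => n; rewrite coefBfps !coef_dilate.
by case: ifP; rewrite ?subr0.
Qed.

Fact fps_dilate_is_monoid_morphism : monoid_morphism fps_dilate.
Proof.
split=> [|a b]; apply/fpsP => n.
  rewrite coef_dilate !coef1fps; case: ifPn => [/dvdnP[k ->]|].
    case: (posnP d) => [->|d0]; first by rewrite muln0.
    by rewrite mulnK // muln_eq0 (gtn_eqF d0) orbF.
  by case: n => //; rewrite dvdn0.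
case: (posnP d) => [d0|d0].
  case: n => [|n]; first by rewrite coef0Mfps !coef0_dilate coef0Mfps.
  rewrite coefMfps coef_dilate d0 big1 // => -[i lt_in] _ /=.
  rewrite !coef_dilate d0 !dvd0n.
  by case: i lt_in => [|i] _; rewrite ?mul0r // subn0 mulr0.
(* For d > 0, dilation is composition with 'X^d on truncations.               *)
pose T (c : fps R) := fps_trunc n.+1 c.
have TE c i : (i <= n)%N -> (T c)`_i = c`[i] by rewrite coef_poly ltnS => ->.
have TdE c i : (i <= n)%N -> (T c \Po 'X^d)`_i = (fps_dilate c)`[i].
  move=> le_in; rewrite coef_comp_poly_Xn // coef_dilate.
  by rewrite TE // (leq_trans (leq_div _ _)).
transitivity (((T a * T b) \Po 'X^d)`_n).
  rewrite coef_comp_poly_Xn // coef_dilate; case: ifP => // _.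
  have le_n := leq_div n d; rewrite coefM coefMfps; apply: eq_bigr => i _.
  by rewrite !TE // ?(leq_trans (leq_subr _ _)) // (leq_trans _ le_n) // -ltnS.
rewrite comp_polyM coefM coefMfps; apply: eq_bigr => i _.
by rewrite !TdE ?leq_subr // -ltnS.
Qed.

HB.instance Definition _ :=
  GRing.isZmodMorphism.Build (fps R) (fps R) fps_dilate
    fps_dilate_is_zmod_morphism.
HB.instance Definition _ :=
  GRing.isMonoidMorphism.Build (fps R) (fps R) fps_dilate
    fps_dilate_is_monoid_morphism.

Lemma fps_dilate_cvg (u : nat -> fps R) a :
  fps_cvg u a -> fps_cvg (fun m => fps_dilate (u m)) (fps_dilate a).
Proof.
move=> ua n; apply: filterS (ua (n %/ d)%N) => m uam.
by rewrite !coef_dilate uam.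
Qed.

Lemma fps_dilate_qpoch x q : q`[0] = 0 ->
  fps_dilate (qpoch x q) = qpoch (fps_dilate x) (fps_dilate q).
Proof.
move=> q0; have dq0 : (fps_dilate q)`[0] = 0 by rewrite coef0_dilate.
have := qpochn_cvg (fps_dilate x) dq0; apply: fps_cvg_unique.
apply: eq_fps_cvg (fps_dilate_cvg (qpochn_cvg x q0)) => m.
rewrite rmorph_prod; apply: eq_bigr => k _.
by rewrite rmorphB rmorph1 rmorphM rmorphXn.
Qed.

Lemma fps_dilateX : (0 < d)%N -> fps_dilate fpsX = fpsX ^+ d.
Proof.
move=> d0; apply/fpsP => n; rewrite coef_fpsXn coef_dilate.
case: ifPn => [/dvdnP[k ->]|nd].
  by rewrite mulnK // -{2}[d]mul1n eqn_pmul2r.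
by case: eqP nd => // ->; rewrite dvdnn.
Qed.

End Dilation.

Section Bisection.
Context {R : comNzRingType}.
Implicit Types (a b : fps R).

Lemma coef_fpsXM a n : (fpsX * a)`[n.+1] = a`[n].
Proof.
rewrite coefMfps big_ord_recl mul0r add0r big_ord_recl mul1r subn1.
by rewrite big1 ?addr0 // => i _; rewrite mul0r.
Qed.

Lemma fps_even_part a b :
  FPS (fun n => (fps_dilate 2 a + fpsX * fps_dilate 2 b)`[2 * n]) = a.
Proof.
apply/fpsP => n; rewrite [LHS]/fps_coef coefDfps coef_dilate.
rewrite dvdn_mulr // mulKn //; case: n => [|n].
  by rewrite coef0Mfps mul0r addr0.
by rewrite mulnS coef_fpsXM coef_dilate dvdn2 /= mul2n odd_double addr0.
Qed.

Lemma fps_odd_part a b :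
  FPS (fun n => (fps_dilate 2 a + fpsX * fps_dilate 2 b)`[2 * n + 1]) = b.
Proof.
apply/fpsP => n; rewrite [LHS]/fps_coef addn1 coefDfps coef_fpsXM !coef_dilate.
by rewrite dvdn_mulr // mulKn // dvdn2 /= mul2n odd_double add0r.
Qed.

End Bisection.

Section UnitQuotients.
Context {R : comUnitRingType}.
Implicit Types x y z t : R.

Lemma mulr_div_unit x y z t : y \is a GRing.unit -> t \is a GRing.unit ->
  x / y * (z / t) = (x * z) / (y * t).
Proof. by move=> yU tU; rewrite invrM // mulrACA [t^-1 * _]mulrC. Qed.

Lemma eq_div_unit x y z t : y \is a GRing.unit -> t \is a GRing.unit ->
  x * t = z * y -> x / y = z / t.
Proof.
by move=> yU tU xtE; apply: (mulIr tU); rewrite divrK // mulrAC xtE mulrK.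
Qed.

End UnitQuotients.

Section EulerProducts.
Context {R : comUnitRingType}.
Implicit Types q : fps R.

Definition euler q : fps R := qpoch q q.

Lemma euler_unit q : q`[0] = 0 -> euler q \is a GRing.unit.
Proof. by move=> q0; apply: qpoch_unit_coef0. Qed.

Lemma euler_dissection q d : q`[0] = 0 -> (0 < d)%N ->
  euler q = \prod_(j < d) qpoch (q ^+ j.+1) (q ^+ d).
Proof.
move=> q0 d0; rewrite [euler q](qpoch_dissection q q0 d0).
by apply: eq_bigr => j _; rewrite -exprS.
Qed.

Lemma euler_dissection2 q : q`[0] = 0 ->
  euler q = qpoch q (q ^+ 2) * euler (q ^+ 2).
Proof.
move=> q0; rewrite (euler_dissection q0 (isT : 0 < 2)%N).
by rewrite !big_ord_recl big_ord0 mulr1.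
Qed.

Lemma euler_dissection3 q : q`[0] = 0 ->
  euler q = qpoch q (q ^+ 3) * qpoch (q ^+ 2) (q ^+ 3) * euler (q ^+ 3).
Proof.
move=> q0; rewrite (euler_dissection q0 (isT : 0 < 3)%N).
by rewrite !big_ord_recl big_ord0 mulr1 mulrA.
Qed.

Lemma qpoch_q_q5_q6 q : q`[0] = 0 ->
  qpoch q (q ^+ 6) * qpoch (q ^+ 5) (q ^+ 6) * (euler (q ^+ 2) * euler (q ^+ 3))
  = euler q * euler (q ^+ 6).
Proof.
move=> q0; rewrite (euler_dissection q0 (isT : 0 < 6)%N).
rewrite (euler_dissection3 (coef0Xfps q0 (isT : 0 < 2)%N)).
rewrite (euler_dissection2 (coef0Xfps q0 (isT : 0 < 3)%N)).
rewrite !big_ord_recl big_ord0 -!exprM -[qpoch (q ^+ 6) _]/(euler (q ^+ 6)).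
by ring.
Qed.

Lemma theta_q_q2 q : q`[0] = 0 ->
  theta q (q ^+ 2)
  = (euler (q ^+ 2) * euler (q ^+ 3) ^+ 2) / (euler q * euler (q ^+ 6)).
Proof.
move=> q0; have q2_0 := coef0Xfps q0 (isT : 0 < 2)%N.
have q3_0 := coef0Xfps q0 (isT : 0 < 3)%N.
have U : euler q * euler (q ^+ 6) \is a GRing.unit.
  by apply: rpredM; apply: euler_unit => //; apply: coef0Xfps.
apply: (canRL (mulrK U)); rewrite (@jacobi_triple_product _ q (q ^+ 2) q3_0).
rewrite (euler_dissection3 q0) (euler_dissection3 q2_0) -(exprS q 2).
have := qpochMN q q3_0; have := qpochMN (q ^+ 2) q3_0.
rewrite -!exprM => <- <-.
rewrite -[qpoch (q ^+ 3) _]/(euler (q ^+ 3)) -[(2 * 3)%N]/6%N.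
(* Without this generalization [ring] would unfold the powers of [q].         *)
move: (qpoch q _) (qpoch (- q) _) (qpoch (q ^+ 2) _) (qpoch (- q ^+ 2) _).
by move: (euler (q ^+ 3)) (euler (q ^+ 6)) => *; ring.
Qed.

Lemma theta_q5_q q : q`[0] = 0 ->
  theta (q ^+ 5) q
  = (euler (q ^+ 2) ^+ 2 * euler (q ^+ 3) * euler (q ^+ 12))
    / (euler q * euler (q ^+ 4) * euler (q ^+ 6)).
Proof.
move=> q0; have q2_0 := coef0Xfps q0 (isT : 0 < 2)%N.
have q6_0 := coef0Xfps q0 (isT : 0 < 6)%N.
have U : euler q * euler (q ^+ 4) * euler (q ^+ 6) \is a GRing.unit.
  by do 2?[apply: rpredM]; apply: euler_unit => //; apply: coef0Xfps.
apply: (canRL (mulrK U)).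
have q5qE : q ^+ 5 * q = q ^+ 6 by rewrite -exprSr.
rewrite (@jacobi_triple_product _ (q ^+ 5) q) q5qE //.
rewrite -[qpoch (q ^+ 6) _]/(euler (q ^+ 6)).
have := qpoch_q_q5_q6 q0; have := qpoch_q_q5_q6 q2_0.
rewrite !(exprAC q 2) -(qpochMN q q6_0) -(qpochMN (q ^+ 5) q6_0) -!exprM.
rewrite -[(2 * 2)%N]/4%N -[(3 * 2)%N]/6%N -[(6 * 2)%N]/12%N.
move: (qpoch q _) (qpoch (- q) _) (qpoch (q ^+ 5) _) (qpoch (- q ^+ 5) _).
move: (euler q) (euler (q ^+ 2)) (euler (q ^+ 3)) (euler (q ^+ 4)).
move: (euler (q ^+ 6)) (euler (q ^+ 12)) => e6 e12 e1 e2 e3 e4 x xN y yN.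
move=> q2E qE.
transitivity (yN * xN * (e4 * e6) * (e1 * e6)); first by ring.
rewrite -qE; transitivity (e2 * e12 * (e2 * e3)); last by ring.
by rewrite -q2E; ring.
Qed.

End EulerProducts.

Lemma schur_gf_eta : schur_gf = (f 2 * f 3) / (f 1 * f 6 ^+ 2).
Proof.
have U : f 1 * f 6 ^+ 2 \is a GRing.unit.
  by apply: rpredM; rewrite ?unitrX ?f_unit.
apply: (canRL (mulrK U)); have := @qpoch_q_q5_q6 _ (fpsX : fps int) (erefl _).
rewrite -[euler fpsX]/(f 1) -[euler (fpsX ^+ 2)]/(f 2).
rewrite -[euler (fpsX ^+ 3)]/(f 3) -[euler (fpsX ^+ 6)]/(f 6).
have := schur_gfE; rewrite -[qpoch (fpsX ^+ 6) _]/(f 6).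
move: schur_gf (qpoch fpsX _) (qpoch (fpsX ^+ 5) _) (f 1) (f 2) (f 3) (f 6).
move=> g x y f1 f2 f3 f6 gE f1f6E.
rewrite expr2 mulrA -f1f6E.
by transitivity (g * (x * y * f6) * (f2 * f3)); [ring | rewrite gE mul1r].
Qed.

Lemma theta_Xr_X2r r : (0 < r)%N ->
  theta (fpsX ^+ r) (fpsX ^+ (2 * r))
  = (f (2 * r) * f (3 * r) ^+ 2) / (f r * f (6 * r)).
Proof.
move=> r0; rewrite ![(_ * r)%N]mulnC /f !exprM.
exact: theta_q_q2 (coef0Xfps _ r0).
Qed.

Lemma theta_X5r_Xr r : (0 < r)%N ->
  theta (fpsX ^+ (5 * r)) (fpsX ^+ r)
  = (f (2 * r) ^+ 2 * f (3 * r) * f (12 * r))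
    / (f r * f (4 * r) * f (6 * r)).
Proof.
move=> r0; rewrite ![(_ * r)%N]mulnC /f !exprM.
exact: theta_q5_q (coef0Xfps _ r0).
Qed.

Lemma fps_dilate_f d r : (0 < d)%N -> (0 < r)%N ->
  fps_dilate d (f r) = f (d * r).
Proof.
move=> d0 r0; rewrite /f fps_dilate_qpoch; last exact: coef0Xfps.
by rewrite rmorphXn /= (fps_dilateX d0) exprM.
Qed.

Lemma schur_gf_theta :
  schur_gf = theta fpsX (fpsX ^+ 5) * (f 4 / (f 2 * f 6 * f 12)).
Proof.
rewrite (@thetaC _ fpsX); last by rewrite coef0Mfps mul0r.
have -> : theta (fpsX ^+ 5) fpsX
    = (f 2 ^+ 2 * f 3 * f 12) / (f 1 * f 4 * f 6) by exact: (@theta_X5r_Xr 1).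
rewrite schur_gf_eta.
(* [f] is generalized to keep unification from unfolding infinite products.   *)
move: f_unit; move: f => e eU.
rewrite mulr_div_unit ?unitrM ?eU //.
by apply: eq_div_unit; rewrite ?unitrM ?unitrX ?eU //; ring.
Qed.

Lemma theta_X_X5_dissection (R : comNzRingType) :
  theta fpsX (fpsX ^+ 5)
  = theta (fpsX ^+ 8) (fpsX ^+ 16) + fpsX * theta (fpsX ^+ 20) (fpsX ^+ 4)
    :> fps R.
Proof.
have x2z0 : (fpsX ^+ 2 * fpsX ^+ 4 : fps R)`[0] = 0.
  by rewrite -exprD coef_fpsXn.
rewrite (exprD fpsX 1 4) (exprD fpsX 4 4) (exprD fpsX 4 (4 * 3)).
by rewrite (exprD fpsX 8 (4 * 3)) !exprM; apply: theta_dissection.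
Qed.

Lemma schur_gf_dissection :
  schur_gf
  = fps_dilate 2 ((f 2 * f 8 * f 12 ^+ 2) / (f 1 * f 3 * f 4 * f 6 * f 24))
    + fpsX * fps_dilate 2 ((f 4 ^+ 2 * f 24) / (f 1 * f 3 * f 8 * f 12)).
Proof.
rewrite schur_gf_theta theta_X_X5_dissection.
rewrite (theta_Xr_X2r (isT : 0 < 8)%N) (theta_X5r_Xr (isT : 0 < 4)%N).
move: f_unit (@fps_dilate_f 2); move: f => e eU De.
rewrite mulrDl -[fpsX * _ * _]mulrA.
rewrite !mulr_div_unit ?unitrM ?eU // !rmorph_div ?unitrM ?eU //.
rewrite !rmorphM /= !De //.
by congr (_ + _ * _); apply: eq_div_unit; rewrite ?unitrM ?eU //; ring.
Qed.

Theorem theorem3p1 :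
  FPS (fun n : nat => schur_overpartitions (2 * n)%N)
    = (f 2 * f 8 * f 12 ^+ 2) / (f 1 * f 3 * f 4 * f 6 * f 24)
  /\ FPS (fun n : nat => schur_overpartitions (2 * n + 1)%N)
    = (f 4 ^+ 2 * f 24) / (f 1 * f 3 * f 8 * f 12).
Proof.
rewrite /schur_overpartitions schur_gf_dissection.
by split; [apply: fps_even_part | apply: fps_odd_part].
Qed.
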